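(* The following conditions are equivalent for every simple graph $G$: (i) For every vertex $v$ of $G$ there is a unique vertex $u$ of $G$ such that $u$ and $v$ are adjacent. (ii) There are an ultrametric $d$ on the set $X=V(G)$ and disjoint proximinal subsets $A$, $B$ of $(X,d)$ such that $X=A\cup B$, $G$ is bipartite with the parts $A$ and $B$, and $G$ is path-proximinal for $A$ and $B$ with respect to the ultrametric $d$.
   Context: Graphs are simple (no loops, no multiple edges), have a nonempty vertex set $V(G)$ and edge set $E(G)$, and may be infinite. A graph is bipartite with parts $A$ and $B$ if $A,B$ are nonempty, disjoint, $V(G)=A\cup B$, and no edge has both ends in the same part. An ultrametric on a nonempty set $X$ is a function $d\colon X\times X\to[0,\infty)$ with $d(x,y)=d(y,x)$, $d(x,y)=0\Leftrightarrow x=y$, and $d(x,y)\le\max\{d(x,z),d(z,y)\}$ for all $x,y,z\in X$. A nonempty subset $A$ of $(X,d)$ is proximinal if for every $x\in X$ there is $a_0\in A$ with $d(x,a_0)=\inf\{d(x,a)\colon a\in A\}$. For nonempty $A,B\subseteq X$, $\operatorname{dist}(A,B):=\inf\{d(a,b)\colon a\in A,\ b\in B\}$. A path is a finite graph $P$ whose (distinct) vertices can be numbered $u_0,\dots,u_k$, $k\ge 1$, so that $E(P)=\{\{u_0,u_1\},\dots,\{u_{k-1},u_k\}\}$. Let $A,B$ be nonempty disjoint sets. A path $P$ is a be-path of $A$ and $B$ if $V(P)\subseteq A\cup B$ and there is exactly one edge $\{a_0,b_0\}\in E(P)$ meeting both $A$ and $B$. A graph $G$ is a path-bipartite graph of $A$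 and $B$ if $A,B\subseteq V(G)$ and $G$ is the union (of vertex sets and of edge sets) of a nonempty set of be-paths of $A$ and $B$. For such $G$ and $X=A\cup B=V(G)$, $G$ is path-proximinal for $A$ and $B$ with respect to $d$ if $A$ and $B$ are proximinal subsets of $(X,d)$ and, for all distinct $x,y\in X$, $\{x,y\}\in E(G)\Leftrightarrow d(x,y)\le\operatorname{dist}(A,B)$. *)

(* Defs.v *)
From HB Require Import structures.
From mathcomp Require Import all_boot all_order all_algebra.
From mathcomp Require Import all_classical all_reals.

Set Implicit Arguments.
Unset Strict Implicit.
Unset Printing Implicit Defensive.

Import Order.TTheory GRing.Theory Num.Theory.

Local Open Scope classical_set_scope.
Local Open Scope ring_scope.

(* The vertices of a graph form a subset of an ambient type T, so that the
   subgraphs of a graph and their unions are again of type [graph T].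
   Edges are two-element sets of vertices. *)
Record graph (T : Type) := Graph {
  vertices : set T;
  edges : set (set T);
  vertices_nonempty : vertices !=set0;
  edgesP : forall e, edges e ->
    exists x y, [/\ vertices x, vertices y, x <> y & e = [set x; y]] }.

Definition adjacent (T : Type) (G : graph T) (x y : T) : Prop :=
  edges G [set x; y].

Definition bipartite (T : Type) (G : graph T) (A B : set T) : Prop :=
  [/\ A !=set0, B !=set0, A `&` B = set0, vertices G = A `|` B &
      forall e, edges G e -> ~ (e `<=` A) /\ ~ (e `<=` B)].

(* An ultrametric on a subset X of T is represented by a total function on T,
   whose values outside X * X are irrelevant. *)
Definition ultrametric_on (R : realType) (T : Type) (X : set T)
    (d : T -> T -> R) : Prop :=
  [/\ forall x y, X x -> X y -> 0 <= d x y,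
      forall x y, X x -> X y -> d x y = d y x,
      forall x y, X x -> X y -> (d x y = 0 <-> x = y) &
      forall x y z, X x -> X y -> X z ->
        d x y <= Num.max (d x z) (d z y)].

(* Below, [inf] is only taken of nonempty sets of nonnegative reals, where it
   is the greatest lower bound. *)
Definition proximinal (R : realType) (T : Type) (X : set T)
    (d : T -> T -> R) (A : set T) : Prop :=
  [/\ A !=set0, A `<=` X &
      forall x, X x -> exists2 a0, A a0 & d x a0 = inf [set d x a | a in A]].

Definition set_dist (R : realType) (T : Type) (d : T -> T -> R)
    (A B : set T) : R :=
  inf [set d a b | a in A & b in B].

Definition is_path (T : Type) (P : graph T) : Prop :=
  exists (k : nat) (u : nat -> T),
    [/\ (1 <= k)%N, set_inj `I_k.+1 u, vertices P = [set u i | i in `I_k.+1] &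
        edges P = [set [set u i; u i.+1] | i in `I_k]].

Definition be_path (T : Type) (A B : set T) (P : graph T) : Prop :=
  [/\ is_path P, vertices P `<=` A `|` B &
      exists! e : set T, [/\ edges P e, e `&` A !=set0 & e `&` B !=set0]].

Definition path_bipartite (T : Type) (G : graph T) (A B : set T) : Prop :=
  [/\ A !=set0, B !=set0, A `&` B = set0,
      A `<=` vertices G /\ B `<=` vertices G &
      exists F : set (graph T),
        [/\ F !=set0, F `<=` be_path A B,
            vertices G = \bigcup_(P in F) vertices P &
            edges G = \bigcup_(P in F) edges P]].

Definition path_proximinal (R : realType) (T : Type) (G : graph T)
    (A B : set T) (d : T -> T -> R) : Prop :=
  [/\ path_bipartite G A B, vertices G = A `|` B,
      proximinal (vertices G) d A, proximinal (vertices G) d B &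
      forall x y, vertices G x -> vertices G y -> x <> y ->
        (adjacent G x y <-> d x y <= set_dist d A B)].

(* Main.v *)
(** In an ultrametric space, [d x y <= r] is an equivalence relation, so two
    neighbours of a vertex of a path-proximinal graph are equal or adjacent;
    bipartiteness rules out the latter.  Conversely, if every vertex has exactly
    one neighbour, the edges partition the vertices into pairs: let [A] contain
    one chosen end of each edge and [B] the others, and let the distance of
    distinct points be [1] along edges and [2] elsewhere.  Each edge is itself
    a be-path. *)
Require Import Defs.
From HB Require Import structures.
From mathcomp Require Import all_boot all_order all_algebra.
From mathcomp Require Import all_classical all_reals.

Import Order.TTheory GRing.Theory Num.Theory.

Local Open Scope classical_set_scope.
Local Open Scope ring_scope.

(** Distances from a point to a part, and between the parts, are computed below by exhibiting a
    minimum. *)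
Lemma inf_attained (R : realType) (E : set R) (m : R) :
  E m -> lbound E m -> inf E = m.
Proof.
move=> Em lbm; apply/eqP; rewrite eq_le; apply/andP; split.
  by apply: ge_inf => //; exists m.
by apply: lb_le_inf => //; exists m.
Qed.

Section Graphs.
Context {T : Type}.
Implicit Types (G P : graph T) (A B : set T) (x y z u v : T).

(** * Neighbours in paths, path-bipartite graphs and bipartite graphs *)

Lemma adjacentC {G} {x y} : adjacent G x y -> adjacent G y x.
Proof. by rewrite /adjacent setUC. Qed.

Lemma edge_ends {G} {e} : edges G e ->
  exists x y, [/\ vertices G x, vertices G y, x <> y, adjacent G x y &
                  e = [set x; y]].
Proof.
move=> Ge; have [x [y [Gx Gy xy eE]]] := edgesP Ge.
by exists x, y; split=> //; rewrite /adjacent -eE.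
Qed.

Lemma adjacent_vertices {G} {x y} : adjacent G x y ->
  [/\ vertices G x, vertices G y & x <> y].
Proof.
move=> /[dup] Gxy /edgesP[a [b [Ga Gb ab E]]].
have sub z : [set x; y] z -> vertices G z by rewrite E => -[]->.
split; [by apply: sub; left | by apply: sub; right |].
(* If [x = y], the edge is a singleton, so its two ends [a] and [b] coincide. *)
move=> xy; apply: ab.
have [-> ->] : a = x /\ b = x; last by [].
have : [set x; y] a by rewrite E; left.
have : [set x; y] b by rewrite E; right.
by rewrite -xy => -[]-> []->.
Qed.

Lemma path_vertex_adjacent {P} {v} : is_path P -> vertices P v ->
  exists u, adjacent P u v.
Proof.
move=> [[|k] [w [// _ _ VP EP]]]; rewrite VP => -[i /= ik <-].
(* The last index is now [k.+1]: earlier vertices have a successor, the last one has the predecessor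
   [w k]. *)
have [ik1|ki] := ltnP i k.+1.
  by exists (w i.+1); apply: adjacentC; rewrite /adjacent EP; exists i.
have -> : i = k.+1 by apply/eqP; rewrite eqn_leq ki -ltnS ik.
by exists (w k); rewrite /adjacent EP; exists k => /=.
Qed.

Lemma path_bipartite_adjacent {G A B} {v} : path_bipartite G A B ->
  vertices G v -> exists u, adjacent G u v.
Proof.
move=> [_ _ _ _ [F [_ Fbe VG EG]]]; rewrite VG => -[P FP Pv].
have [pathP _ _] := Fbe _ FP.
have [u uv] := path_vertex_adjacent pathP Pv.
by exists u; rewrite /adjacent EG; exists P.
Qed.

(** By pigeonhole two of the three vertices share a part, which then contains the edge joining
    them. *)
Lemma bipartite_triangle_free {G A B} {x y z} : bipartite G A B ->
  adjacent G x z -> adjacent G z y -> ~ adjacent G x y.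
Proof.
move=> [_ _ _ VG noin] xz zy xy.
have [Gx Gz _] := adjacent_vertices xz; have [_ Gy _] := adjacent_vertices zy.
have [xzA xzB] := noin _ xz; have [zyA zyB] := noin _ zy.
have [xyA xyB] := noin _ xy; move: Gx Gy Gz; rewrite VG.
have sub2 C a b : C a -> C b -> [set a; b] `<=` C by move=> Ca Cb c []->.
move=> [Ax|Bx] [Ay|By] [Az|Bz];
  by [case: xyA; apply: sub2 | case: xyB; apply: sub2
    | case: xzA; apply: sub2 | case: xzB; apply: sub2
    | case: zyA; apply: sub2 | case: zyB; apply: sub2].
Qed.

Lemma path_proximinal_unique_neighbour (R : realType) {G A B}
    {d : T -> T -> R} : ultrametric_on (vertices G) d -> bipartite G A B ->
  path_proximinal G A B d ->
  forall v, vertices G v -> exists! u, vertices G u /\ adjacent G u v.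
Proof.
move=> [_ _ _ dmax] bip [pb _ _ _ adjE] v Gv.
have [u uv] := path_bipartite_adjacent pb Gv.
have [Gu _ neq_uv] := adjacent_vertices uv.
exists u; split=> // w [Gw wv]; apply: contrapT => neq_uw.
have vw := adjacentC wv; have [_ _ neq_vw] := adjacent_vertices vw.
apply: (bipartite_triangle_free bip uv vw); apply/adjE => //.
apply: le_trans (dmax _ _ v Gu Gw Gv) _.
by rewrite ge_max; apply/andP; split; apply/adjE.
Qed.

(** * A single edge as a be-path *)

Section EdgeGraph.
Context {x y : T} (neq_xy : x <> y).

Lemma edge_graph_vertices_nonempty : [set x; y] !=set0.
Proof. by exists x; left. Qed.

Lemma edge_graph_edgesP e : [set [set x; y]] e ->
  exists a b, [/\ [set x; y] a, [set x; y] b, a <> b & e = [set a; b]].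
Proof. by move=> ->; exists x, y; split=> //; [left | right]. Qed.

Definition edge_graph : graph T :=
  Graph edge_graph_vertices_nonempty edge_graph_edgesP.

Lemma edge_graph_is_path : is_path edge_graph.
Proof.
(* Only the values at [0] and [1] matter. *)
exists 1%N, (fun i => if i is 0%N then x else y); split=> //=.
- move=> [|[|i]] [|[|j]]; rewrite ?inE //= => _ _ E;
    by case: neq_xy.
- apply/seteqP; split=> [z []->|z [[|i] _ <-]]; [| |by left|by right].
    by exists 0%N.
  by exists 1%N.
- apply/seteqP; split=> [e ->|e [[|i] // _ <-]//]; by exists 0%N.
Qed.

Lemma edge_graph_be_path A B : A x -> B y -> be_path A B edge_graph.
Proof.
move=> Ax By; split; [exact: edge_graph_is_path | by move=> z []->; [left|right] |].
exists [set x; y]; split; last by move=> e [].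
by split=> //; [exists x; split=> //; left | exists y; split=> //; right].
Qed.

End EdgeGraph.

(** * The ultrametric and the two parts obtained from a perfect matching *)

Section PerfectMatching.
Context (R : realType) (G : graph T).
Hypothesis matching :
  forall v, vertices G v -> exists! u, vertices G u /\ adjacent G u v.

Lemma matched v : vertices G v -> exists u, adjacent G u v.
Proof. by move=> /matching[u [[_ uv] _]]; exists u. Qed.

Lemma matched_unique {u w v} : adjacent G u v -> adjacent G w v -> u = w.
Proof.
move=> uv wv; have [Gu Gv _] := adjacent_vertices uv.
have [Gw _ _] := adjacent_vertices wv.
have [t [_ tP]] := matching v Gv.
by rewrite -(tP u) // -(tP w).
Qed.

(** Equality and adjacency are decided classically, [T] being an arbitrary type. *)
Definition matching_dist x y : R :=
  if `[< x = y >] then 0 else if `[< adjacent G x y >] then 1 else 2.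

Lemma matching_distxx x : matching_dist x x = 0.
Proof. by rewrite /matching_dist asboolT. Qed.

Lemma matching_dist_adjacent {x y} : adjacent G x y -> matching_dist x y = 1.
Proof.
move=> xy; have [_ _ neq] := adjacent_vertices xy.
by rewrite /matching_dist asboolF // asboolT.
Qed.

Lemma matching_dist_ge1 {x y} : x <> y -> 1 <= matching_dist x y.
Proof.
move=> neq; rewrite /matching_dist asboolF //.
by case: ifP => _ //; rewrite ler1n.
Qed.

(** Once the parts are known to be at distance [1], this is the edge criterion of
    path-proximinality. *)
Lemma matching_dist_le1 {x y} : x <> y ->
  matching_dist x y <= 1 <-> adjacent G x y.
Proof.
move=> neq; split=> [|/matching_dist_adjacent->//].
rewrite /matching_dist asboolF //; case: ifP => [/asboolP//|_].
by rewrite lern1.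
Qed.

Lemma matching_dist_ge0 x y : 0 <= matching_dist x y.
Proof. by rewrite /matching_dist; do ?case: ifP. Qed.

Lemma matching_dist_le2 x y : matching_dist x y <= 2.
Proof. by rewrite /matching_dist; do ?case: ifP => _; rewrite ?ler0n ?ler1n. Qed.

Lemma matching_dist_ge2 {x y} : x <> y -> ~ adjacent G x y ->
  2 <= matching_dist x y.
Proof. by move=> neq nadj; rewrite /matching_dist !asboolF. Qed.

Lemma matching_dist_ultrametric : ultrametric_on (vertices G) matching_dist.
Proof.
split=> [x y _ _|x y _ _|x y _ _|x y z _ _ _].
- exact: matching_dist_ge0.
- by rewrite /matching_dist /adjacent setUC; congr (if _ then _ else _);
    apply/asboolP/asboolP.
- split=> [d0|->]; last exact: matching_distxx.
  by apply: contrapT => /matching_dist_ge1; rewrite d0 ler10.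
have [<-|xy] := pselect (x = y).
  by rewrite matching_distxx le_max matching_dist_ge0.
have [<-|xz] := pselect (x = z); first by rewrite le_max lexx orbT.
have [<-|zy] := pselect (z = y); first by rewrite le_max lexx.
(* The points are now pairwise distinct. As [z] has only one neighbour, one of the pairs [x], [z]
   and [z], [y] is not an edge and has the maximal distance [2]. *)
have [adj|nadj] := pselect (adjacent G x z).
  rewrite le_max; apply/orP; right; apply: le_trans (matching_dist_le2 x y) _.
  apply: matching_dist_ge2 => // /adjacentC adj'.
  exact: xy (matched_unique adj adj').
rewrite le_max; apply/orP; left; apply: le_trans (matching_dist_le2 x y) _.
exact: matching_dist_ge2.
Qed.

(** A point of [A] is its own nearest point. For a point outside, a neighbour in [A] attains [1],
    the least distance between distinct points. *)
Lemma matching_dist_proximinal A : A !=set0 -> A `<=` vertices G ->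
  (forall x, vertices G x -> ~ A x -> exists2 y, A y & adjacent G x y) ->
  proximinal (vertices G) matching_dist A.
Proof.
move=> A0 AG outA; split=> // x Gx.
have [Ax|nAx] := pselect (A x).
  exists x => //; rewrite matching_distxx; symmetry.
  apply: inf_attained; first by exists x => //; exact: matching_distxx.
  by move=> _ [y _ <-]; exact: matching_dist_ge0.
have [y Ay xy] := outA x Gx nAx.
exists y => //; rewrite (matching_dist_adjacent xy); symmetry.
apply: inf_attained; first by exists y => //; exact: matching_dist_adjacent.
by move=> _ [z Az <-]; apply: matching_dist_ge1 => xz; rewrite xz in nAx.
Qed.

Lemma matching_set_dist A B x y : A `&` B = set0 -> A x -> B y ->
  adjacent G x y -> set_dist matching_dist A B = 1.
Proof.
move=> AB0 Ax By xy; apply: inf_attained.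
  by exists x => //; exists y => //; exact: matching_dist_adjacent.
move=> _ [a Aa [b Bb <-]]; apply: matching_dist_ge1 => ab.
by have : (A `&` B) a; [split=> //; rewrite ab | rewrite AB0].
Qed.

Lemma matching_split : exists A B,
  [/\ A `&` B = set0, vertices G = A `|` B,
      forall x y, adjacent G x y -> A x -> B y &
      forall x y, adjacent G x y -> B x -> A y].
Proof.
have /choice[c cP] : forall e, exists x, edges G e -> e x.
  move=> e.
  (* Off the edges the value of [c] is irrelevant, and any vertex serves. *)
  have [Ge|nGe] := pselect (edges G e); last first.
    by have [v _] := vertices_nonempty G; exists v.
  by have [x [y [_ _ _ _ ->]]] := edge_ends Ge; exists x => _; left.
pose A := [set x | exists2 y, adjacent G x y & c [set x; y] = x].
exists A, (vertices G `\` A); split.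
- by rewrite setDE setICA setICr setI0.
- apply/seteqP; split=> [x Gx|x [[y /adjacent_vertices[]//]|[]//]].
  by have [Ax|nAx] := pselect (A x); [left|right].
(* If [x] and [y] were both chosen, uniqueness of neighbours would make both choices come from the
   edge [[set x; y]], forcing [x = y]. *)
- move=> x y xy [z xz cx]; have [_ Gy neq] := adjacent_vertices xy.
  split=> // -[t yt cy]; apply: neq; rewrite -cx -cy.
  rewrite (matched_unique (adjacentC xz) (adjacentC xy)).
  by rewrite (matched_unique (adjacentC yt) xy) setUC.
- move=> x y xy [_ nAx]; exists x; first exact: adjacentC.
  by rewrite setUC; case: (cP _ xy) => // cx; case: nAx; exists y.
Qed.

Lemma matching_path_proximinal : exists A B,
  [/\ proximinal (vertices G) matching_dist A,
      proximinal (vertices G) matching_dist B,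
      bipartite G A B & path_proximinal G A B matching_dist].
Proof.
have [A [B [AB0 GAB toB toA]]] := matching_split.
have AG : A `<=` vertices G by rewrite GAB => x; left.
have BG : B `<=` vertices G by rewrite GAB => x; right.
(* Such an edge shows that both parts are nonempty and, later, that their distance is [1]. *)
have [x0 [y0 [Ax0 By0 xy0]]] : exists x y, [/\ A x, B y & adjacent G x y].
  have [v Gv] := vertices_nonempty G; have [u uv] := matched v Gv.
  have := Gv; rewrite GAB => -[Av|Bv].
    by exists v, u; split=> //; [apply: toB (adjacentC uv) Av|exact: adjacentC].
  by exists u, v; split=> //; apply: toA (adjacentC uv) Bv.
have A0 : A !=set0 by exists x0.
have B0 : B !=set0 by exists y0.
have proxA : proximinal (vertices G) matching_dist A.
  apply: matching_dist_proximinal => // x Gx nAx.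
  have [u /adjacentC xu] := matched x Gx; exists u => //.
  by apply: toA xu _; move: Gx; rewrite GAB => -[].
have proxB : proximinal (vertices G) matching_dist B.
  apply: matching_dist_proximinal => // x Gx nBx.
  have [u /adjacentC xu] := matched x Gx; exists u => //.
  by apply: toB xu _; move: Gx; rewrite GAB => -[].
have disj z : A z -> B z -> False.
  by move=> Az Bz; have : (A `&` B) z by []; rewrite AB0.
have edgeAB e : edges G e ->
    exists x y, [/\ A x, B y, x <> y & e = [set x; y]].
  move=> /edge_ends[x [y [Gx _ neq xy ->]]].
  move: Gx; rewrite GAB => -[Ax|Bx].
    by exists x, y; split=> //; apply: toB xy Ax.
  exists y, x; split=> //; [exact: toA xy Bx | exact: nesym | exact: setUC].
have bip : bipartite G A B.
  split=> // e /edgeAB[x [y [Ax By _ ->]]]; split=> sub.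
    by apply: (disj y) => //; apply: sub; right.
  by apply: (disj x) => //; apply: sub; left.
exists A, B; split=> //; split=> //; last first.
  move=> x y _ _ neq; rewrite (matching_set_dist _ _ _ _ AB0 Ax0 By0 xy0).
  by apply: iff_sym; exact: matching_dist_le1.
(* Taking every be-path with edges in [G] puts the unions inside [G] at once; the one-edge paths of
   [Fedge] already cover [G]. *)
split=> //; pose F := [set P | be_path A B P /\ edges P `<=` edges G].
have Fedge x y : A x -> B y -> adjacent G x y -> exists P,
    [/\ F P, vertices P = [set x; y] & edges P = [set [set x; y]]].
  move=> Ax By xy; have [_ _ neq] := adjacent_vertices xy.
  exists (edge_graph neq); split=> //; split; last by move=> e ->.
  exact: edge_graph_be_path.
exists F; split.
- by have [P [FP _ _]] := Fedge _ _ Ax0 By0 xy0; exists P.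
- by move=> P [].
- apply/seteqP; split=> [x Gx|x [P [[_ PAB _] _] Px]]; last first.
    by rewrite GAB; exact: PAB.
  have [u ux] := matched x Gx; have := Gx; rewrite GAB => -[Ax|Bx].
    have [P [FP VP _]] :=
      Fedge x u Ax (toB _ _ (adjacentC ux) Ax) (adjacentC ux).
    by exists P => //; rewrite VP; left.
  have [P [FP VP _]] := Fedge u x (toA _ _ (adjacentC ux) Bx) Bx ux.
  by exists P => //; rewrite VP; right.
- apply/seteqP; split=> [e Ge|e [P [_ PG] Pe]]; last exact: PG.
  have [x [y [Ax By _ eE]]] := edgeAB e Ge.
  have xy : adjacent G x y by rewrite /adjacent -eE.
  by have [P [FP _ EP]] := Fedge x y Ax By xy; exists P => //; rewrite EP.
Qed.

End PerfectMatching.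
End Graphs.

Theorem theorem3p10 (R : realType) (T : Type) (G : graph T) :
  (forall v, vertices G v -> exists! u, vertices G u /\ adjacent G u v) <->
  (exists (d : T -> T -> R) (A B : set T),
    ultrametric_on (vertices G) d /\
    A `&` B = set0 /\
    proximinal (vertices G) d A /\
    proximinal (vertices G) d B /\
    vertices G = A `|` B /\
    bipartite G A B /\
    path_proximinal G A B d).
Proof.
split=> [matching|[d [A [B [um [_ [_ [_ [_ [bip pp]]]]]]]]]]; last first.
  exact: path_proximinal_unique_neighbour um bip pp.
have [A [B [proxA proxB bip pp]]] := matching_path_proximinal R G matching.
exists (matching_dist R G), A, B; have [_ _ AB0 GAB _] := bip.
by split; first exact: matching_dist_ultrametric.
Qed.
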